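(* Let $f,g\in\mathbb{Z}[X]$ be nonconstant polynomials with $f(0)g(0)\neq 0$ such that $|Res(f,g)|$ is a prime number. Then both $f$ and $g$ are irreducible over $\mathbb{Q}$ in each one of the following cases: i) $|\theta-\xi|>1$ for every root $\theta\in\mathbb{C}$ of $f$ and every root $\xi\in\mathbb{C}$ of $g$; ii) $\left|\frac{1}{\theta}-\frac{1}{\xi}\right|>1$ for every root $\theta\in\mathbb{C}$ of $f$ and every root $\xi\in\mathbb{C}$ of $g$.
   Context: $Res(f,g)$ denotes the resultant of $f$ and $g$: if $f=a_n\prod_{i=1}^n(X-\theta_i)$ and $g=b_m\prod_{j=1}^m(X-\xi_j)$ over $\mathbb{C}$, then $Res(f,g)=a_n^m b_m^n\prod_{i,j}(\theta_i-\xi_j)$. *)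

(* Defs.v *)
From HB Require Import structures.
From mathcomp Require Import all_boot all_order all_algebra.
From mathcomp Require Import ring.

Set Implicit Arguments.
Unset Strict Implicit.
Unset Printing Implicit Defensive.

Import Order.TTheory GRing.Theory Num.Theory.
Local Open Scope ring_scope.

(* [Sylvester_mx p q] with its dimensions freed from the sizes of p and q. *)
Definition syl (A : nzRingType) (m n : nat) (p q : {poly A}) : 'M[A]_(m + n) :=
  \matrix_(i, j) match split i with
                 | inl k => p`_(j - k) *+ (k <= j)
                 | inr k => q`_(j - k) *+ (k <= j)
                 end.

Lemma resultant_syl (A : comNzRingType) (p q : {poly A}) :
  resultant p q = \det (syl (size q).-1 (size p).-1 p q).
Proof.
congr (\det _); apply/matrixP=> i j; rewrite Sylvester_mxE mxE.
by case: split.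
Qed.

Lemma band_horner (A : comNzRingType) (N k : nat) (p : {poly A}) (x : A) :
  (k + size p <= N)%N ->
  \sum_(j < N) (p`_(j - k) *+ (k <= j)) * x ^+ j = x ^+ k * p.[x].
Proof.
move=> le_N; rewrite -[RHS]mulrC -(hornerXn x k) -hornerM.
rewrite (@horner_coef_wide _ N); last first.
  rewrite (leq_trans (size_polyMleq _ _)) // size_polyXn addnS /=.
  by rewrite addnC.
apply: eq_bigr => j _; rewrite coefMXn; case: leqP => //= _.
Qed.

Lemma det_syl (A : comNzRingType) (m n : nat) (p q : {poly A})
    (y : 'rV[A]_m) (x : 'rV[A]_n) :
  (size p <= n.+1)%N -> (size q <= m.+1)%N ->
  (forall i, p.[x 0 i] = 0) -> (forall j, q.[y 0 j] = 0) ->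
  \det (syl m n p q) * \det (Vandermonde (m + n) (row_mx y x)) =
  (\prod_j p.[y 0 j] * \det (Vandermonde m y)) *
  (\prod_i q.[x 0 i] * \det (Vandermonde n x)).
Proof.
move=> sp sq p0 q0; rewrite -det_mulmx.
have -> : syl m n p q *m Vandermonde (m + n) (row_mx y x) =
  block_mx (Vandermonde m y *m diag_mx (\row_j p.[y 0 j])) 0
           0 (Vandermonde n x *m diag_mx (\row_i q.[x 0 i])).
  apply/matrixP=> i l; rewrite !mxE.
  under eq_bigr => j _ do rewrite !mxE.
  case: (splitP i) => k ik; rewrite band_horner;
    try by rewrite -addnS leq_add // 1?addnC ?leq_add.
  - rewrite mxE; case: (splitP l) => h lh.
    + rewrite mul_mx_diag !mxE //.
    + by rewrite p0 mulr0 mxE.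
  - apply: leq_trans (leq_add (leqnn _) sp) _.
    by rewrite addnS -addSn leq_add.
  - rewrite mxE; case: (splitP l) => h lh.
    + by rewrite q0 mulr0 mxE.
    + rewrite mul_mx_diag !mxE //.
  - apply: leq_trans (leq_add (leqnn _) sq) _.
    by rewrite addnS -addSn addnC leq_add.
rewrite det_ublock !det_mulmx !det_diag.
congr (_ * _); rewrite mulrC; congr (_ * _); apply: eq_bigr => j _;
  by rewrite mxE.
Qed.

Lemma det_Vdm (A : comNzRingType) (m n : nat) (y : 'rV[A]_m) (x : 'rV[A]_n) :
  \det (Vandermonde (m + n) (row_mx y x)) =
  \det (Vandermonde m y) * \det (Vandermonde n x) *
  \prod_j \prod_i (x 0 i - y 0 j).
Proof.
rewrite !det_Vandermonde big_split_ord /=.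
have -> : \prod_(j < m) \prod_(i < m + n | (lshift n j < i)%N)
      (row_mx y x 0 i - row_mx y x 0 (lshift n j)) =
    (\prod_(j < m) \prod_(i < m | (j < i)%N) (y 0 i - y 0 j)) *
    \prod_j \prod_i (x 0 i - y 0 j).
  rewrite -big_split; apply: eq_bigr => j _; rewrite big_split_ord /=.
  congr (_ * _); first by apply: eq_bigr => i _; rewrite !row_mxEl.
  apply: eq_big => [i | i _]; first by rewrite ltn_addr.
  by rewrite row_mxEl row_mxEr.
have -> : \prod_(j < n) \prod_(i < m + n | (rshift m j < i)%N)
      (row_mx y x 0 i - row_mx y x 0 (rshift m j)) =
    \prod_(j < n) \prod_(i < n | (j < i)%N) (x 0 i - x 0 j).
  apply: eq_bigr => j _; rewrite big_split_ord /= big_pred0 ?mul1r.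
    apply: eq_big => [i | i _]; first by rewrite ltn_add2l.
    by rewrite !row_mxEr.
  by move=> i; apply/negbTE; rewrite -leqNgt ltnW // ltn_addr.
by rewrite -!mulrA; congr (_ * _); rewrite mulrC.
Qed.

Definition lprod (A : comNzRingType) (a : A) (n : nat) (x : 'I_n -> A) :=
  a *: \prod_i ('X - (x i)%:P).

Lemma size_lprod (A : comNzRingType) (a : A) n (x : 'I_n -> A) :
  (size (lprod a x) <= n.+1)%N.
Proof.
apply: leq_trans (size_scale_leq _ _) _.
by rewrite size_prod_XsubC /index_enum -enumT size_enum_ord.
Qed.

Lemma horner_lprod (A : comNzRingType) (a : A) n (x : 'I_n -> A) z :
  (lprod a x).[z] = a * \prod_i (z - x i).
Proof.
rewrite hornerZ horner_prod; congr (_ * _); apply: eq_bigr => i _.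
by rewrite !hornerE.
Qed.

Lemma syl_distinct (A : idomainType) m n a b (y : 'I_m -> A) (x : 'I_n -> A) :
  injective x -> injective y -> (forall i j, x i != y j) ->
  \det (syl m n (lprod a x) (lprod b y)) =
  a ^+ m * b ^+ n * \prod_j \prod_i (y j - x i).
Proof.
move=> injx injy nxy.
pose Y := \row_j y j; pose X := \row_i x i.
have Vn0 k (z : 'I_k -> A) : injective z ->
    \det (Vandermonde k (\row_j z j)) != 0.
  move=> iz; rewrite det_Vandermonde; apply/prodf_neq0 => i _.
  apply/prodf_neq0 => j ltij; rewrite !mxE subr_eq0.
  by apply: contraTneq ltij => /iz ->; rewrite ltnn.
have D0 : \det (Vandermonde (m + n) (row_mx Y X)) != 0.
  rewrite det_Vdm !mulf_neq0 ?Vn0 //.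
  apply/prodf_neq0 => j _; apply/prodf_neq0 => i _.
  by rewrite !mxE subr_eq0.
apply: (mulIf D0); rewrite det_syl ?size_lprod //; first last.
- move=> j; rewrite mxE horner_lprod (bigD1 j) //= subrr mul0r mulr0 //.
- move=> j; rewrite mxE horner_lprod (bigD1 j) //= subrr mul0r mulr0 //.
rewrite det_Vdm.
have -> : \prod_j (lprod a x).[Y 0 j] = a ^+ m * \prod_j \prod_i (y j - x i).
  under eq_bigr => j _ do rewrite mxE horner_lprod.
  by rewrite big_split /= prodr_const card_ord.
have -> : \prod_i (lprod b y).[X 0 i] =
    b ^+ n * \prod_j \prod_i (X 0 i - Y 0 j).
  rewrite exchange_big /=.
  under eq_bigr => j _ do rewrite mxE horner_lprod.
  rewrite big_split /= prodr_const card_ord; congr (_ * _).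
  by apply: eq_bigr => i _; apply: eq_bigr => j _; rewrite !mxE.
set P := \prod_j \prod_i (y j - x i).
set Q := \prod_j \prod_i (X 0 i - Y 0 j).
set u := \det _; set v := \det _; set c := a ^+ m; set d := b ^+ n.
by ring.
Qed.

Lemma det_syl_lprod (C : numFieldType) m n a b (y : 'I_m -> C) (x : 'I_n -> C) :
  \det (syl m n (lprod a x) (lprod b y)) =
  a ^+ m * b ^+ n * \prod_j \prod_i (y j - x i).
Proof.
pose X' i : {poly C} := (x i)%:P + 'X *+ (m + i).
pose Y' j : {poly C} := (y j)%:P + 'X *+ j.
have coefpert (c : C) k : (c%:P + 'X *+ k)`_1 = k%:R.
  by rewrite coefD coefC coefMn coefX add0r.
have eqpert (c d : C) k l : c%:P + 'X *+ k = d%:P + 'X *+ l -> k = l.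
  move=> /(congr1 (fun p : {poly C} => p`_1)); rewrite !coefpert => /eqP.
  by rewrite eqr_nat => /eqP.
have injX : injective X' by move=> i j /eqpert /addnI /val_inj.
have injY : injective Y' by move=> i j /eqpert /val_inj.
have nXY i j : X' i != Y' j.
  apply/eqP => /eqpert E; have := ltn_ord j.
  by rewrite -E ltnNge leq_addr.
(* The roots may coincide: perturb them over C[X], then set X to 0. *)
have := syl_distinct a%:P b%:P injX injY nXY.
pose ev : {rmorphism {poly C} -> C} := horner_eval (0 : C).
move=> /(congr1 ev).
have evc (c : C) k : ev (c%:P + 'X *+ k) = c.
  by rewrite /ev /= /horner_eval hornerD hornerC hornerMn hornerX mul0rn addr0.
have evC (c : C) : ev c%:P = c by rewrite /ev /= /horner_eval hornerC.
have evl (c : C) k (z : 'I_k -> C) (z' : 'I_k -> {poly C}) :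
    (forall i, ev (z' i) = z i) -> map_poly ev (lprod c%:P z') = lprod c z.
  move=> ez; rewrite /lprod map_polyZ rmorph_prod evC; congr (_ *: _).
  by apply: eq_bigr => i _; rewrite rmorphB /= map_polyX map_polyC /= ez.
rewrite -det_map_mx !rmorphM !rmorphXn /= !evC rmorph_prod /=.
have evX i : ev (X' i) = x i by rewrite evc.
have evY j : ev (Y' j) = y j by rewrite evc.
move=> E; rewrite -(evl a n x X' evX) -(evl b m y Y' evY).
transitivity (\det (map_mx ev (syl m n (lprod a%:P X') (lprod b%:P Y')))).
  congr (\det _); apply/matrixP => i j; rewrite !mxE.
  by case: split => k; rewrite rmorphMn coef_map.
rewrite E; congr (_ * _); apply: eq_bigr => j _; rewrite rmorph_prod /=.
by apply: eq_bigr => i _; rewrite rmorphB /= !evc.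
Qed.

(* [resultant] is the determinant of the Sylvester matrix with coefficients
   listed from the constant term up; it differs from
     a ^+ deg g * b ^+ deg f * \prod (theta - xi)
   by the sign (-1) ^+ (deg f * deg g). Here s and t list the roots of f and g
   with multiplicity. *)
Lemma resultant_prod (C : numFieldType) (f g : {poly int}) (s t : seq C) (a b : C) :
    a != 0 -> b != 0 ->
    map_poly intr f = a *: \prod_(theta <- s) ('X - theta%:P) ->
    map_poly intr g = b *: \prod_(xi <- t) ('X - xi%:P) ->
  (resultant f g)%:~R =
  (-1) ^+ (size s * size t) *
  (a ^+ size t * b ^+ size s *
   \prod_(theta <- s) \prod_(xi <- t) (theta - xi)).
Proof.
move=> a0 b0 Df Dg.
have szE (h : {poly int}) (c : C) r : c != 0 ->
    map_poly intr h = c *: \prod_(z <- r) ('X - z%:P) -> (size h).-1 = size r.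
  move=> c0 Dh; rewrite -(@size_map_inj_poly _ C intr) //; last exact: intr_inj.
  by rewrite Dh size_scale // size_prod_XsubC.
rewrite resultant_syl (szE f _ _ a0 Df) (szE g _ _ b0 Dg) -det_map_mx.
pose x (i : 'I_(size s)) := s`_i; pose y (j : 'I_(size t)) := t`_j.
have -> : map_mx intr (syl (size t) (size s) f g) =
    syl (size t) (size s) (lprod a x) (lprod b y).
  have -> : lprod a x = map_poly intr f.
    by rewrite Df (big_nth 0) big_mkord.
  have -> : lprod b y = map_poly intr g.
    by rewrite Dg (big_nth 0) big_mkord.
  apply/matrixP => i j; rewrite !mxE.
  by case: split => k; rewrite rmorphMn coef_map.
rewrite det_syl_lprod mulrCA; congr (_ * _).
rewrite exchange_big /= mulnC exprM -[size s in RHS]card_ord -prodr_const.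
rewrite [X in _ = _ * X](big_nth 0) big_mkord -big_split; apply: eq_bigr => i _.
rewrite -[size t in RHS]card_ord -prodr_const (big_nth 0) big_mkord -big_split.
by apply: eq_bigr => j _ /=; rewrite mulN1r opprB.
Qed.

(* Main.v *)
Require Import Defs.
From mathcomp Require Import all_boot all_order all_algebra.
From mathcomp Require Import algC reals complex ring.
Import Order.TTheory GRing.Theory Num.Theory.
Local Open Scope ring_scope.
Local Open Scope complex_scope.

Set Implicit Arguments.
Unset Strict Implicit.
Unset Printing Implicit Defensive.

(** The resultant is multiplicative in each argument, so a factorization
    f = h * r over the integers (to which a factorization over the rationals
    reduces by Gauss's lemma) writes the prime |Res(f, g)| as
    |Res(h, g)| * |Res(r, g)|, where one of the two factors must be 1.  On the
    other hand, the separation of the roots forces |Res(h, g)| > 1 for every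
    nonconstant divisor h of f, hence h or r is constant.

    The lower bound comes from the two ways to write the resultant in terms of
    the roots theta of h and xi of g, where m = deg h and n = deg g:
      |Res(h, g)| = |lc h|^n |lc g|^m prod |theta - xi|
                  = |h(0)|^n |g(0)|^m prod |1/theta - 1/xi|.
    The second form follows from the first because
    |theta - xi| = |theta| |xi| |1/theta - 1/xi| and
    |h(0)| = |lc h| prod |theta|.  In both forms the factors before the product
    are powers of nonzero integers, so that |Res(h, g)| is at least a
    nonempty product of numbers greater than 1 (absz_resultant_gt1_sub and
    absz_resultant_gt1_inv).  The two arguments of the resultant are
    interchangeable up to sign, which gives the irreducibility of g. *)

(** * Resultants and roots *)

(** The roots with multiplicity, in any order.  The zero polynomial is excluded
    because the factorization would then hold for every list. *)
Definition root_list (C : numClosedFieldType) (f : {poly int}) (s : seq C) :=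
  f != 0 /\
  map_poly intr f = (lead_coef f)%:~R *: \prod_(theta <- s) ('X - theta%:P).

Lemma root_list_exists (C : numClosedFieldType) (f : {poly int}) :
  f != 0 -> exists s : seq C, root_list f s.
Proof.
move=> f0.
have [s Ds] := closed_field_poly_normal (map_poly intr f : {poly C}).
by exists s; split; rewrite // {1}Ds lead_coef_map_inj //; exact: intr_inj.
Qed.

Lemma size_root_list (C : numClosedFieldType) (f : {poly int}) (s : seq C) :
  root_list f s -> size f = (size s).+1.
Proof.
case=> f0 Df; rewrite -(@size_map_inj_poly _ C intr) //; last exact: intr_inj.
by rewrite Df size_scale ?intr_eq0 ?lead_coef_eq0 // size_prod_XsubC.
Qed.

Lemma root_list_root (C : numClosedFieldType) (f : {poly int}) (s : seq C) :
  root_list f s -> forall theta, theta \in s -> root (map_poly intr f) theta.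
Proof.
case=> f0 -> theta s_th.
by rewrite rootZ ?intr_eq0 ?lead_coef_eq0 // root_prod_XsubC.
Qed.

Lemma normr_horner0 (C : numClosedFieldType) (f : {poly int}) (s : seq C) :
  root_list f s ->
  `|f.[0]%:~R| = `|(lead_coef f)%:~R| * \prod_(theta <- s) `|theta| :> C.
Proof.
case=> f0 Df; have -> : f.[0]%:~R = (map_poly intr f : {poly C}).[0].
  by rewrite -[0 in RHS](rmorph0 (intr : int -> C)) horner_map.
rewrite Df hornerZ horner_prod normrM normr_prod; congr (_ * _).
by apply: eq_bigr => theta _; rewrite !hornerE normrN.
Qed.

Lemma root_list_neq0 (C : numClosedFieldType) (f : {poly int}) (s : seq C) :
  root_list f s -> f.[0] != 0 -> forall theta, theta \in s -> theta != 0.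
Proof.
move=> Ds f00 theta s_th; apply: contraNneq f00 => th0.
rewrite -(intr_eq0 C) -normr_eq0 (normr_horner0 Ds).
by rewrite (big_rem theta) //= th0 normr0 mul0r mulr0.
Qed.

Lemma normr_resultant (C : numClosedFieldType) (f g : {poly int})
    (s t : seq C) :
  root_list f s -> root_list g t ->
  `|(resultant f g)%:~R| =
  `|(lead_coef f)%:~R| ^+ size t * `|(lead_coef g)%:~R| ^+ size s *
  \prod_(theta <- s) \prod_(xi <- t) `|theta - xi| :> C.
Proof.
case=> f0 Df [g0 Dg].
rewrite (resultant_prod _ _ Df Dg) ?intr_eq0 ?lead_coef_eq0 //.
rewrite !normrM !normrX normrN1 expr1n mul1r normr_prod; congr (_ * _).
by apply: eq_bigr => theta _; rewrite normr_prod.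
Qed.

Lemma prod_pairM (C : comPzRingType) (s t : seq C) (u v : C -> C) :
  \prod_(x <- s) \prod_(y <- t) (u x * v y) =
  (\prod_(x <- s) u x) ^+ size t * (\prod_(y <- t) v y) ^+ size s.
Proof.
under eq_bigr => x _ do
  rewrite big_split /= big_const_seq count_predT iter_mulr_1.
rewrite big_split /= prodrXl; congr (_ * _).
by rewrite big_const_seq count_predT iter_mulr_1.
Qed.

(** Distributing |theta - xi| = |theta| |xi| |1/theta - 1/xi| over the product
    turns the leading coefficients into constant terms. *)
Lemma normr_resultant_inv (C : numClosedFieldType) (f g : {poly int})
    (s t : seq C) :
  root_list f s -> root_list g t -> f.[0] != 0 -> g.[0] != 0 ->
  `|(resultant f g)%:~R| =
  `|f.[0]%:~R| ^+ size t * `|g.[0]%:~R| ^+ size s *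
  \prod_(theta <- s) \prod_(xi <- t) `|theta^-1 - xi^-1| :> C.
Proof.
move=> Ds Dt f00 g00; rewrite (normr_resultant Ds Dt).
have -> : \prod_(theta <- s) \prod_(xi <- t) `|theta - xi| =
    \prod_(theta <- s) \prod_(xi <- t) (`|theta| * `|xi|) *
    \prod_(theta <- s) \prod_(xi <- t) `|theta^-1 - xi^-1|.
  rewrite -big_split; apply: eq_big_seq => theta /(root_list_neq0 Ds f00).
  move=> th0; rewrite -big_split; apply: eq_big_seq => xi.
  move=> /(root_list_neq0 Dt g00) xi0 /=.
  by rewrite -!normrM distrC mulrBr mulfK // mulrAC divff // mul1r.
rewrite (normr_horner0 Ds) (normr_horner0 Dt) prod_pairM !exprMn.
by rewrite !mulrA; congr (_ * _ * _); rewrite mulrAC.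
Qed.

(** * Symmetry and multiplicativity of the resultant *)

(** Swapping f and g only turns each theta - xi into xi - theta. *)
Lemma absz_resultantC (f g : {poly int}) :
  f != 0 -> g != 0 -> `|resultant f g|%N = `|resultant g f|%N.
Proof.
move=> /(root_list_exists algC)[s Ds] /(root_list_exists algC)[t Dt].
apply: (@mulrIn algC 1); rewrite ?oner_eq0 // !natr_absz !intr_norm.
rewrite (normr_resultant Ds Dt) (normr_resultant Dt Ds).
rewrite exchange_big /=; congr (_ * _); first exact: mulrC.
by apply: eq_bigr => xi _; apply: eq_bigr => theta _; rewrite distrC.
Qed.

(** A list of the roots of a product is the concatenation of the lists of the
    roots of the factors, and leading coefficients multiply. *)
Lemma absz_resultantMl (f1 f2 g : {poly int}) :
  f1 != 0 -> f2 != 0 -> g != 0 ->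
  `|resultant (f1 * f2) g|%N = (`|resultant f1 g| * `|resultant f2 g|)%N.
Proof.
move=> /(root_list_exists algC)[s1 Ds1] /(root_list_exists algC)[s2 Ds2].
move=> /(root_list_exists algC)[t Dt].
have Ds12 : root_list (f1 * f2) (s1 ++ s2).
  case: Ds1 Ds2 => f10 D1 [f20 D2]; split; first by rewrite mulf_neq0.
  rewrite rmorphM /= D1 D2 lead_coefM rmorphM /= big_cat /=.
  by rewrite -scalerAl -scalerAr scalerA.
apply: (@mulrIn algC 1); rewrite ?oner_eq0 // natrM !natr_absz !intr_norm.
rewrite (normr_resultant Ds12 Dt) (normr_resultant Ds1 Dt).
rewrite (normr_resultant Ds2 Dt) big_cat /= size_cat exprD.
rewrite lead_coefM rmorphM normrM exprMn /=; ring.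
Qed.

(** * Separated roots bound the resultant from below *)

Lemma normr_intr_ge1 (C : numDomainType) (n : int) :
  n != 0 -> 1 <= `|n%:~R| :> C.
Proof.
by move=> n0; rewrite -intr_norm -natr_absz ler1n absz_gt0.
Qed.

Lemma prod_seq_gt1 (C : numDomainType) (I : eqType) (s : seq I) (F : I -> C) :
  (0 < size s)%N -> (forall x, x \in s -> 1 < F x) -> 1 < \prod_(x <- s) F x.
Proof.
elim: s => // x [|y s] IHs _ F_gt1; rewrite big_cons.
  by rewrite big_nil mulr1 F_gt1 ?inE.
rewrite mulr_egt1 ?F_gt1 ?inE ?eqxx // IHs // => z yz.
by rewrite F_gt1 // inE yz orbT.
Qed.

Lemma mulr_ge1_gt1 (C : numDomainType) (x y : C) :
  1 <= x -> 1 < y -> 1 < x * y.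
Proof.
move=> x1 y1; apply: (lt_le_trans y1).
by rewrite ler_peMl // ltW // (lt_trans ltr01).
Qed.

(** The leading coefficients are nonzero integers, so the product over the
    pairs of roots, which is nonempty, bounds the resultant from below. *)
Lemma absz_resultant_gt1_sub (C : numClosedFieldType) (f g : {poly int}) :
  (1 < size f)%N -> (1 < size g)%N ->
  (forall theta xi : C, root (map_poly intr f) theta ->
     root (map_poly intr g) xi -> 1 < `|theta - xi|) ->
  (1 < `|resultant f g|)%N.
Proof.
move=> f_gt1 g_gt1 sep.
have [s Ds] : exists s : seq C, root_list f s.
  by apply: root_list_exists; rewrite -size_poly_gt0 ltnW.
have [t Dt] : exists t : seq C, root_list g t.
  by apply: root_list_exists; rewrite -size_poly_gt0 ltnW.
rewrite -(ltr1n C) natr_absz intr_norm (normr_resultant Ds Dt).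
apply: mulr_ge1_gt1.
  case: Ds Dt => f0 _ [g0 _].
  by rewrite mulr_ege1 ?exprn_ege1 ?normr_intr_ge1 ?lead_coef_eq0.
apply: prod_seq_gt1 => [|theta s_th].
  by rewrite -ltnS -(size_root_list Ds).
apply: prod_seq_gt1 => [|xi t_xi].
  by rewrite -ltnS -(size_root_list Dt).
by apply: sep; [exact: (root_list_root Ds) | exact: (root_list_root Dt)].
Qed.

(** The same bound, with the nonzero integers f(0) and g(0) in place of the
    leading coefficients. *)
Lemma absz_resultant_gt1_inv (C : numClosedFieldType) (f g : {poly int}) :
  (1 < size f)%N -> (1 < size g)%N -> f.[0] != 0 -> g.[0] != 0 ->
  (forall theta xi : C, root (map_poly intr f) theta ->
     root (map_poly intr g) xi -> 1 < `|theta^-1 - xi^-1|) ->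
  (1 < `|resultant f g|)%N.
Proof.
move=> f_gt1 g_gt1 f00 g00 sep.
have [s Ds] : exists s : seq C, root_list f s.
  by apply: root_list_exists; rewrite -size_poly_gt0 ltnW.
have [t Dt] : exists t : seq C, root_list g t.
  by apply: root_list_exists; rewrite -size_poly_gt0 ltnW.
rewrite -(ltr1n C) natr_absz intr_norm (normr_resultant_inv Ds Dt) //.
apply: mulr_ge1_gt1.
  by rewrite mulr_ege1 // exprn_ege1 // normr_intr_ge1.
apply: prod_seq_gt1 => [|theta s_th].
  by rewrite -ltnS -(size_root_list Ds).
apply: prod_seq_gt1 => [|xi t_xi].
  by rewrite -ltnS -(size_root_list Dt).
by apply: sep; [exact: (root_list_root Ds) | exact: (root_list_root Dt)].
Qed.

(** * Irreducibility *)

(** A nontrivial factorization of f splits the prime |Res(f, g)| into two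
    factors greater than 1. *)
Lemma irreducible_of_prime_resultant (f g : {poly int}) :
  (1 < size f)%N -> g != 0 -> prime `|resultant f g|%N ->
  (forall h r : {poly int}, f = h * r -> (1 < size h)%N ->
     (1 < `|resultant h g|)%N) ->
  irreducible_poly (map_poly intr f : {poly rat}).
Proof.
move=> f_gt1 g0 pr res_gt1; split; first by rewrite size_rat_int_poly.
move=> q q_n1 q_dv; rewrite -dvdp_size_eqp // size_rat_int_poly.
have [h [a a0 Dq] [r Df]] := dvdpP_rat_int q_dv.
have f0 : f != 0 by rewrite -size_poly_gt0 ltnW.
have [h0 r0] : h != 0 /\ r != 0 by apply/andP; rewrite -negb_or -mulf_eq0 -Df.
have szq : size q = size h by rewrite Dq size_scale // size_rat_int_poly.
have h_gt1 : (1 < size h)%N.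
  by rewrite ltn_neqAle eq_sym -szq q_n1 szq size_poly_gt0.
rewrite szq Df size_mul //.
have [r_gt1 | r_le1] := ltnP 1 (size r); last first.
  have -> : size r = 1 by apply/eqP; rewrite eqn_leq r_le1 size_poly_gt0.
  by rewrite addn1.
have Rh := res_gt1 _ _ Df h_gt1.
have Rr : (1 < `|resultant r g|)%N by apply: (res_gt1 r h); rewrite // mulrC.
case/primeP: pr => _ /(_ `|resultant h g|%N).
rewrite Df absz_resultantMl // dvdn_mulr // => /(_ isT).
rewrite gtn_eqF //= -{1}[`|resultant h g|%N]muln1 eqn_pmul2l ?(ltnW Rh) //.
by rewrite ltn_eqF.
Qed.

Theorem theoremA (R : realType) (f g : {poly int})
    (hf : (1 < size f)%N) (hg : (1 < size g)%N)
    (h0 : f.[0] * g.[0] != 0)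
    (hres : prime `|resultant f g|%N)
    (hroots :
      (forall theta xi : R[i],
         root (map_poly intr f) theta -> root (map_poly intr g) xi ->
         1 < `|theta - xi|)
      \/
      (forall theta xi : R[i],
         root (map_poly intr f) theta -> root (map_poly intr g) xi ->
         1 < `|theta^-1 - xi^-1|)) :
  irreducible_poly (map_poly intr f : {poly rat}) /\
  irreducible_poly (map_poly intr g : {poly rat}).
Proof.
have f0 : f != 0 by rewrite -size_poly_gt0 ltnW.
have g0 : g != 0 by rewrite -size_poly_gt0 ltnW.
have [f00 g00] : f.[0] != 0 /\ g.[0] != 0.
  by apply/andP; rewrite -negb_or -mulf_eq0.
have root_mull (h r : {poly int}) (z : R[i]) :
    root (map_poly intr h) z -> root (map_poly intr (h * r)) z.
  by rewrite rmorphM rootM /= => ->.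
have hor0_mull (h r : {poly int}) : (h * r).[0] != 0 -> h.[0] != 0.
  by rewrite hornerM mulf_eq0 negb_or => /andP[].
split.
- apply: (@irreducible_of_prime_resultant f g) => // h r Df h_gt1.
  case: hroots => sep.
  + apply: (@absz_resultant_gt1_sub R[i]) => // theta xi h_th.
    by apply: sep; rewrite Df root_mull.
  + apply: (@absz_resultant_gt1_inv R[i]) => // [|theta xi h_th].
      by apply: (hor0_mull h r); rewrite -Df.
    by apply: sep; rewrite Df root_mull.
- apply: (@irreducible_of_prime_resultant g f); rewrite // 1?absz_resultantC //.
  move=> h r Dg h_gt1; case: hroots => sep.
  + apply: (@absz_resultant_gt1_sub R[i]) => // xi theta h_xi f_th.
    by rewrite distrC; apply: sep; rewrite // Dg root_mull.
  + apply: (@absz_resultant_gt1_inv R[i]) => // [|xi theta h_xi f_th].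
      by apply: (hor0_mull h r); rewrite -Dg.
    by rewrite distrC; apply: sep; rewrite // Dg root_mull.
Qed.
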